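(* Let $X$ be a Hausdorff topological group with operations and let $G$ be a regular $G$-method for $X$ which preserves the $G$-convergence of subsequences. Then every $G$-compact subset of $X$ is $G$-closed.
   Context: Groups with operations. A category of groups with operations consists of groups (written additively, not necessarily abelian) with a set of operations $\Omega=\Omega_0\cup\Omega_1\cup\Omega_2$ ($\Omega_i$ the $i$-ary operations) and a set of identities including the group laws, such that: $\Omega_0=\{0\}$; $-\in\Omega_1$, $+\in\Omega_2$; with $\Omega_1'=\Omega_1\setminus\{-\}$ and $\Omega_2'=\Omega_2\setminus\{+\}$, if $\star\in\Omega_2'$ then $\star^\circ$, defined by $x\star^\circ y=y\star x$, is in $\Omega_2'$; and for $\star\in\Omega_2'$, $\omega\in\Omega_1'$ the identities $x\star(y+z)=x\star y+x\star z$, $\omega(x+y)=\omega(x)+\omega(y)$, $\omega(x)\star y=\omega(x\star y)$ hold. A morphism of groups with operations is a group homomorphism preserving the operations of $\Omega_1'$ and $\Omega_2'$. A subgroup with operations is a subgroup closed under all operations in $\Omega_1$ and $\Omega_2$. A topological group with operations is such an object with a topology making all operations continuous. $G$-methods. Let $s(X)$ be the set of all sequences in $X$, a group with operations under termwise operations. A $G$-method for $X$ is a morphism of groups with operations $G\colon c_G(X)\to X$ defined on a subgroup with operations $c_G(X)$ of $s(X)$. A sequence $\mathbf{x}$ is $G$-convergent to $\ell$ if $\mathbf{x}\in c_G(X)$ and $G(\mathbf{x})=\ell$; writing $G(\mathbf{x})=\ell$ includes $\mathbf{x}\in c_G(X)$. $G$ is regular if every convergent sequence $\mathbf{x}$ in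 $X$ lies in $c_G(X)$ and $G(\mathbf{x})=\lim\mathbf{x}$. $G$ preserves the $G$-convergence of subsequences if, whenever $G(\mathbf{x})=\ell$, every subsequence of $\mathbf{x}$ is also $G$-convergent to $\ell$. $G$-closedness and $G$-compactness. A subset $A$ of $X$ is $G$-closed if whenever $\mathbf{x}$ is a sequence of points of $A$ with $G(\mathbf{x})=\ell$, then $\ell\in A$. It is $G$-compact if every sequence of points in $A$ has a subsequence $\mathbf{y}$ with $G(\mathbf{y})=\ell\in A$. *)

(* Defs.v *)
From HB Require Import structures.
From mathcomp Require Import all_boot all_order.
From mathcomp Require Import all_classical topology sequences.
Set Implicit Arguments.
Unset Strict Implicit.
Unset Printing Implicit Defensive.
Local Open Scope classical_set_scope.
Local Open Scope group_scope.

(** The underlying groups are usually written additively but need not be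
    abelian; MathComp's [zmodType] is commutative, so they are [groupType]s
    here: [x * y], [1] and [x^-1] stand for x + y, 0 and -x. *)

(** [un_op] and [bin_op] are Omega_1' and Omega_2', i.e. the unary and binary
    operations other than those of the group; [bin_opp b] is the opposite of
    [b]. *)
Record signature := Signature {
  un_op : Type;
  bin_op : Type;
  bin_opp : bin_op -> bin_op }.

Inductive term (S : signature) :=
| TVar of nat
| TOne
| TInv of term S
| TMul of term S & term S
| TUn of un_op S & term S
| TBin of bin_op S & term S & term S.

(** [identities] holds the equations that a category of groups with operations
    imposes besides the group laws and the axioms of [isGroupWithOps]. *)
Record gwo_category := GwoCategory {
  gwo_sig :> signature;
  identities : set (term gwo_sig * term gwo_sig) }.
Arguments identities : clear implicits.

Section Eval.
Variables (S : signature) (X : groupType).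
Variables (un : un_op S -> X -> X) (bin : bin_op S -> X -> X -> X).

Fixpoint eval (env : nat -> X) (t : term S) : X :=
  match t with
  | TVar n => env n
  | TOne => 1
  | TInv t => (eval env t)^-1
  | TMul t u => eval env t * eval env u
  | TUn w t => un w (eval env t)
  | TBin b t u => bin b (eval env t) (eval env u)
  end.

End Eval.

HB.mixin Record isGroupWithOps (C : gwo_category) X of Group X := {
  unact : un_op C -> X -> X;
  binact : bin_op C -> X -> X -> X;
  binact_opp : forall b x y, binact (bin_opp b) x y = binact b y x;
  binactMr : forall b x y z, binact b x (y * z) = binact b x y * binact b x z;
  unactM : forall w x y, unact w (x * y) = unact w x * unact w y;
  binact_unl : forall w b x y, binact b (unact w x) y = unact w (binact b x y);
  identitiesP : forall t u, identities C (t, u) ->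
    forall env : nat -> X, eval unact binact env t = eval unact binact env u
}.

#[short(type="gwoType")]
HB.structure Definition GroupWithOps (C : gwo_category) :=
  {X of isGroupWithOps C X & Group X}.

Record gwo_morphism (C : gwo_category) (X Y : gwoType C) := GwoMorphism {
  gwo_fun :> X -> Y;
  gwo_funM : {morph gwo_fun : x y / x * y};
  gwo_fun_un : forall w : un_op C, {morph gwo_fun : x / unact w x};
  gwo_fun_bin : forall b : bin_op C, {morph gwo_fun : x y / binact b x y} }.

Record subgwo (C : gwo_category) (X : gwoType C) := SubGwo {
  subgwo_set : set X;
  subgwo1 : subgwo_set 1;
  subgwoM : forall x y, subgwo_set x -> subgwo_set y -> subgwo_set (x * y);
  subgwoV : forall x, subgwo_set x -> subgwo_set x^-1;
  subgwo_un : forall (w : un_op C) x, subgwo_set x -> subgwo_set (unact w x);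
  subgwo_bin : forall (b : bin_op C) x y,
    subgwo_set x -> subgwo_set y -> subgwo_set (binact b x y) }.

Definition subgwo_type (C : gwo_category) (X : gwoType C) (H : subgwo X) : Type :=
  {x : X | x \in subgwo_set H}.

Section SubGwoTheory.
Variables (C : gwo_category) (X : gwoType C) (H : subgwo X).
Local Notation T := (subgwo_type H).

Let mk (x : X) (Hx : subgwo_set H x) : T := exist _ x (mem_set Hx).
Let inH (x : T) : subgwo_set H (sval x) := set_mem (svalP x).

Definition sub_one : T := mk (subgwo1 H).
Definition sub_inv (x : T) : T := mk (subgwoV (inH x)).
Definition sub_mul (x y : T) : T := mk (subgwoM (inH x) (inH y)).
Definition sub_un (w : un_op C) (x : T) : T := mk (subgwo_un w (inH x)).
Definition sub_bin (b : bin_op C) (x y : T) : T :=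
  mk (subgwo_bin b (inH x) (inH y)).

Let sval_inj : injective (fun x : T => sval x).
Proof. exact: (@val_inj _ _ {x : X | x \in subgwo_set H}). Qed.

Fact sub_mulA : associative sub_mul.
Proof. by move=> x y z; apply: sval_inj; exact: mulgA. Qed.
Fact sub_mul1 : left_id sub_one sub_mul.
Proof. by move=> x; apply: sval_inj; exact: mul1g. Qed.
Fact sub_mul1r : right_id sub_one sub_mul.
Proof. by move=> x; apply: sval_inj; exact: mulg1. Qed.
Fact sub_mulV : left_inverse sub_one sub_inv sub_mul.
Proof. by move=> x; apply: sval_inj; exact: mulVg. Qed.
Fact sub_mulVr : right_inverse sub_one sub_inv sub_mul.
Proof. by move=> x; apply: sval_inj; exact: mulgV. Qed.

HB.instance Definition _ := Choice.copy T {x : X | x \in subgwo_set H}.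
HB.instance Definition _ :=
  isGroup.Build T sub_mulA sub_mul1 sub_mul1r sub_mulV sub_mulVr.

Fact sub_binact_opp b x y : sub_bin (bin_opp b) x y = sub_bin b y x.
Proof. by apply: sval_inj; exact: binact_opp. Qed.
Fact sub_binactMr b (x y z : T) :
  sub_bin b x (y * z) = sub_bin b x y * sub_bin b x z.
Proof. by apply: sval_inj; exact: binactMr. Qed.
Fact sub_unactM w (x y : T) : sub_un w (x * y) = sub_un w x * sub_un w y.
Proof. by apply: sval_inj; exact: unactM. Qed.
Fact sub_binact_unl w b x y : sub_bin b (sub_un w x) y = sub_un w (sub_bin b x y).
Proof. by apply: sval_inj; exact: binact_unl. Qed.
Fact sub_identitiesP t u : identities C (t, u) ->
  forall env : nat -> T, eval sub_un sub_bin env t = eval sub_un sub_bin env u.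
Proof.
move=> Ctu env; apply: sval_inj.
have svalE v : sval (eval sub_un sub_bin env v) =
    eval (@unact C X) (@binact C X) (fun i => sval (env i)) v.
  by elim: v => //= [v <-|v <- v' <-|w v <-|b v <- v' <-].
by rewrite !svalE; exact: identitiesP.
Qed.

HB.instance Definition _ := isGroupWithOps.Build C T
  sub_binact_opp sub_binactMr sub_unactM sub_binact_unl sub_identitiesP.
End SubGwoTheory.

Definition sequences (X : Type) : Type := nat -> X.

Section SequencesTheory.
Variables (C : gwo_category) (X : gwoType C).
Local Notation T := (sequences X).

Definition seq_one : T := fun=> 1.
Definition seq_inv (x : T) : T := fun n => (x n)^-1.
Definition seq_mul (x y : T) : T := fun n => x n * y n.
Definition seq_un (w : un_op C) (x : T) : T := fun n => unact w (x n).
Definition seq_bin (b : bin_op C) (x y : T) : T := fun n => binact b (x n) (y n).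

Fact seq_mulA : associative seq_mul.
Proof. by move=> x y z; apply/funext => n; exact: mulgA. Qed.
Fact seq_mul1 : left_id seq_one seq_mul.
Proof. by move=> x; apply/funext => n; exact: mul1g. Qed.
Fact seq_mul1r : right_id seq_one seq_mul.
Proof. by move=> x; apply/funext => n; exact: mulg1. Qed.
Fact seq_mulV : left_inverse seq_one seq_inv seq_mul.
Proof. by move=> x; apply/funext => n; exact: mulVg. Qed.
Fact seq_mulVr : right_inverse seq_one seq_inv seq_mul.
Proof. by move=> x; apply/funext => n; exact: mulgV. Qed.

HB.instance Definition _ := Choice.copy T (nat -> X).
HB.instance Definition _ :=
  isGroup.Build T seq_mulA seq_mul1 seq_mul1r seq_mulV seq_mulVr.

Fact seq_binact_opp b x y : seq_bin (bin_opp b) x y = seq_bin b y x.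
Proof. by apply/funext => n; exact: binact_opp. Qed.
Fact seq_binactMr b (x y z : T) :
  seq_bin b x (y * z) = seq_bin b x y * seq_bin b x z.
Proof. by apply/funext => n; exact: binactMr. Qed.
Fact seq_unactM w (x y : T) : seq_un w (x * y) = seq_un w x * seq_un w y.
Proof. by apply/funext => n; exact: unactM. Qed.
Fact seq_binact_unl w b x y : seq_bin b (seq_un w x) y = seq_un w (seq_bin b x y).
Proof. by apply/funext => n; exact: binact_unl. Qed.
Fact seq_identitiesP t u : identities C (t, u) ->
  forall env : nat -> T, eval seq_un seq_bin env t = eval seq_un seq_bin env u.
Proof.
move=> Ctu env; apply/funext => n.
have nE v : eval seq_un seq_bin env v n =
    eval (@unact C X) (@binact C X) (fun i => env i n) v.
  by elim: v => //= [v <-|v <- v' <-|w v <-|b v <- v' <-].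
by rewrite !nE; exact: identitiesP.
Qed.

HB.instance Definition _ := isGroupWithOps.Build C T
  seq_binact_opp seq_binactMr seq_unactM seq_binact_unl seq_identitiesP.
End SequencesTheory.

HB.mixin Record GroupWithOps_isTopological (C : gwo_category) X
    of Topological X & GroupWithOps C X := {
  mul_continuous : continuous (fun xy : X * X => xy.1 * xy.2);
  inv_continuous : continuous (fun x : X => x^-1);
  unact_continuous : forall w : un_op C, continuous (fun x : X => unact w x);
  binact_continuous : forall b : bin_op C,
    continuous (fun xy : X * X => binact b xy.1 xy.2)
}.

#[short(type="topologicalGwoType")]
HB.structure Definition TopologicalGroupWithOps (C : gwo_category) :=
  {X of GroupWithOps_isTopological C X & Topological X & GroupWithOps C X}.

Record Gmethod (C : gwo_category) (X : gwoType C) := GMethod {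
  Gdom : subgwo (sequences X);
  Gfun :> gwo_morphism (subgwo_type Gdom) X }.

Section GMethods.
Variables (C : gwo_category) (X : topologicalGwoType C) (G : Gmethod X).
Implicit Types (x : sequences X) (l : X) (A : set X).

Definition Gconvergent x l : Prop :=
  exists xG : x \in subgwo_set (Gdom G), G (exist _ x xG) = l.

(** For Hausdorff [X], [x @ \oo --> l] says that [x] converges and that [l] is
    its limit. *)
Definition Gregular : Prop := forall x l, x @ \oo --> l -> Gconvergent x l.

Definition Gpreserves_subsequences : Prop := forall x l, Gconvergent x l ->
  forall f : nat -> nat, increasing_seq f -> Gconvergent (x \o f) l.

Definition Gclosed A : Prop :=
  forall x l, (forall n, A (x n)) -> Gconvergent x l -> A l.

Definition Gcompact A : Prop :=
  forall x, (forall n, A (x n)) ->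
  exists2 f : nat -> nat, increasing_seq f &
    exists2 l, A l & Gconvergent (x \o f) l.

End GMethods.

(* Main.v *)
Require Import Defs.
From mathcomp Require Import all_boot all_order.
From mathcomp Require Import all_classical topology sequences.

(** Let x be a sequence in A with G(x) = l. By G-compactness a subsequence of
    x has a G-limit m in A, and it also has the G-limit l because passing to a
    subsequence preserves G-limits. As G is a function, l = m
    ([Gconvergent_unique]), so l lies in A. *)

Lemma Gconvergent_unique (C : gwo_category) (X : topologicalGwoType C)
    (G : Gmethod X) (x : sequences X) (l m : X) :
  Gconvergent G x l -> Gconvergent G x m -> l = m.
Proof.
(* [G] is applied to [x] paired with a membership proof; two such proofs are
   equal since membership is boolean. *)
by case=> xG <- [xG' <-]; rewrite (bool_irrelevance xG xG').
Qed.

Theorem theorem3p4 (C : gwo_category) (X : topologicalGwoType C)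
    (G : Gmethod X) (A : set X) :
  hausdorff_space X -> Gregular G -> Gpreserves_subsequences G ->
  Gcompact G A -> Gclosed G A.
Proof.
move=> _ _ Gsub Acompact x l Ax xl.
have [f f_incr [m Am xfm]] := Acompact x Ax.
by rewrite (@Gconvergent_unique _ _ _ _ _ _ (Gsub _ _ xl _ f_incr) xfm).
Qed.
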